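(* Let $q\ge 2$ be a real number and let $n=2m+1$ be a positive odd integer. Let $\mathcal{Q}_q$ be the distribution on $\mathbb{N}_0$ with mass function $$p_k=\prod_{i\ge 1,\ i\ \mathrm{odd}}(1-1/q^i)\ \frac{q^{2k+1}}{\prod_{i=1}^{2k+1}(q^i-1)},\qquad k\in\mathbb{N}_0,$$ and let $\mathcal{Q}_{q,n}$ be the distribution on $\{0,\dots,m\}$ with mass function $$p_{k,n}=\frac{N(n,n-1-2k)}{q^{\binom n2}},\qquad N(n,2h)=\prod_{i=1}^h\frac{q^{2i-2}}{q^{2i}-1}\prod_{i=0}^{2h-1}(q^{n-i}-1).$$ Then $$\frac{0.37}{q^{n+2}}\le\|\mathcal{Q}_{q,n}-\mathcal{Q}_q\|_{\mathrm{TV}}\le\frac{2.2}{q^{n+2}} .$$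
   Context: $\mathbb{N}_0=\{0,1,2,\dots\}$. Empty products equal $1$. For probability distributions $P_1,P_2$ on a countable set $S$, $\|P_1-P_2\|_{\mathrm{TV}}=\frac12\sum_{s\in S}|P_1(s)-P_2(s)|$; a distribution on $\{0,\dots,m\}$ is regarded as a distribution on $\mathbb{N}_0$. For $q$ a power of $2$, $N(n,2h)$ is the number of symmetric $n\times n$ matrices with zero diagonal over $\mathbb{F}_q$ of rank $2h$; for odd prime powers $q$ it is the number of skew-symmetric $n\times n$ matrices over $\mathbb{F}_q$ of rank $2h$. *)

(* Defs.v *)
From mathcomp Require Import all_boot all_order all_algebra.
From mathcomp Require Import all_classical all_reals all_analysis.
Set Implicit Arguments.
Unset Strict Implicit.
Unset Printing Implicit Defensive.
Import Order.TTheory GRing.Theory Num.Theory.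
Import numFieldNormedType.Exports.
Local Open Scope ring_scope.

(* [P] and [Q] are the mass functions of distributions on nat.  The series of
   nonnegative terms is taken in \bar R, where its value always exists. *)
Definition tv_dist (R : realType) (P Q : nat -> R) : \bar R :=
  ((2^-1)%:E * \sum_(0 <= k <oo) `|P k - Q k|%:E)%E.

Definition odd_prod (R : realType) (q : R) : R :=
  limn (fun N : nat => \prod_(1 <= i < N | odd i) (1 - 1 / q ^+ i)).

Definition Q_mass (R : realType) (q : R) (k : nat) : R :=
  odd_prod q *
    (q ^+ (2 * k + 1) / \prod_(1 <= i < (2 * k + 1).+1) (q ^+ i - 1)).

(* This is N(n, 2h): the argument [h] is half of the rank. *)
Definition rank_count (R : realType) (q : R) (n h : nat) : R :=
  \prod_(1 <= i < h.+1) (q ^+ (2 * i - 2) / (q ^+ (2 * i) - 1)) *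
  \prod_(0 <= i < 2 * h) (q ^+ (n - i) - 1).

(* For odd n, n./2 is (n - 1) / 2 and the rank n - 1 - 2k is 2 (n./2 - k). *)
Definition Qn_mass (R : realType) (q : R) (n k : nat) : R :=
  if (k <= n./2)%N then rank_count q n (n./2 - k) / q ^+ 'C(n, 2) else 0.

(* Main.v *)
Require Import Defs.
From mathcomp Require Import all_boot all_order all_algebra.
From mathcomp Require Import all_classical all_reals all_analysis.
From mathcomp Require Import ring lra zify.
Set Implicit Arguments.
Unset Strict Implicit.
Unset Printing Implicit Defensive.
Import Order.TTheory GRing.Theory Num.Theory.
Import numFieldNormedType.Exports.
Local Open Scope ring_scope.

(** Write x = 1/q and n = 2m+1. Replacing every factor q^i - 1 by
    q^i (1 - x^i) turns the two mass functions into multiples of the same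
    coefficient A_k = q^(2k+1) / prod_(1 <= i <= 2k+1) (q^i - 1), namely

      p_k     = A_k * b          with b = prod_(i odd) (1 - x^i),
      p_(k,n) = A_k * a * T_k    with a = prod_(i odd, i <= n) (1 - x^i) and
                                      T_k = prod_(m-k < i <= m) (1 - x^(2i)),

    where T_k is to be read as 0 for k > m ([Qn_massE], [Q_massE]). So the
    difference of the masses measures how far the products b / a and T_k are
    from each other. Since x^2 <= 1/4, a product of factors 1 - c x^(2j) that
    starts at j = s lies between 1 - (4/3) c x^(2s) and 1 - c x^(2s)
    ([geo_prod_ge], [geo_prod_le]). Hence
    1 - (4/3) x^(n+2) <= b / a <= 1 - x^(n+2) ([odd_prod_bounds]) and
    1 - (4/3) x^(2(m-k)+2) <= T_k <= 1.

    For the lower bound the term k = 0 is enough. There T_0 = 1, and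
    A_0 a >= 5/6, so that half of the term is at least (5/12) x^(n+2), and
    5/12 > 0.37 ([mass_diff0_ge]).

    For the upper bound, the term k = 0 is at most (4/3) x^(n+2)
    ([mass_diff0_le]). For k >= 1 the error of T_k dominates; it exceeds x^(n+2)
    by a factor of order q^(2k+1), but A_k decays like q^(-k(2k+1)), and
    A_k (1 - x) q^(2k+1) is at most 32/21 for k = 1 and shrinks at least
    eightfold at each further step ([mass_coef_geometric]). Summing the
    geometric series gives a total below 4.4 x^(n+2), and half of it is the
    bound ([sum_mass_diff_le]). *)

(** * Products of factors tending geometrically to one *)

(** The partial products of [odd_prod] and the correction factors of [Qn_mass]
    both have this form: ratio [y = q^-2], with [c = q^-1] for odd exponents and
    [c = q^-2] for even ones. *)
Definition geo_prod (R : realType) (c y : R) (s t : nat) : R :=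
  \prod_(s <= j < t) (1 - c * y ^+ j).

Section GeoProd.
Variables (R : realType) (c y : R).
Hypotheses (c0 : 0 <= c) (c1 : c <= 1) (y0 : 0 <= y) (y4 : y <= 1 / 4).

Lemma geo_factor_ge0 j : 0 <= 1 - c * y ^+ j.
Proof.
have y1 : y <= 1 by move: y4; lra.
by rewrite subr_ge0 mulr_ile1 ?exprn_ge0 ?exprn_ile1.
Qed.

Lemma geo_factor_le1 j : 1 - c * y ^+ j <= 1.
Proof. by rewrite gerBl mulr_ge0 ?exprn_ge0. Qed.

Lemma geo_prod_ge0 s t : 0 <= geo_prod c y s t.
Proof. by apply: prodr_ge0 => j _; exact: geo_factor_ge0. Qed.

Lemma geo_prod_le1 s t : geo_prod c y s t <= 1.
Proof.
by apply: prodr_ile1 => j; rewrite geo_factor_ge0 geo_factor_le1.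
Qed.

(** A product of factors 1 - e_j is at least 1 - sum e_j; the geometric series
    with ratio at most 1/4 contributes the factor 4/3. *)
Lemma geo_prod_ge s t : 1 - 4 / 3 * c * y ^+ s <= geo_prod c y s t.
Proof.
have [st|ts] := leqP s t; last first.
  rewrite /geo_prod big_geq 1?ltnW //.
  have : 0 <= c * y ^+ s by rewrite mulr_ge0 ?exprn_ge0.
  lra.
(* The term y ^+ t is the unspent tail of the series, which lets the
   induction on t go through. *)
suff : 1 - 4 / 3 * c * (y ^+ s - y ^+ t) <= geo_prod c y s t.
  have : 0 <= c * y ^+ t by rewrite mulr_ge0 ?exprn_ge0.
  lra.
elim: t st => [|t IHt].
  by rewrite leqn0 => /eqP->; rewrite /geo_prod big_geq //; lra.
rewrite leq_eqVlt => /predU1P[->|].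
  by rewrite /geo_prod big_geq //; lra.
rewrite ltnS => st; rewrite /geo_prod big_nat_recr //= -/(geo_prod c y s t).
have f0 := geo_factor_ge0 t.
apply: le_trans (ler_wpM2r f0 (IHt st)).
have ct0 : 0 <= c * y ^+ t by rewrite mulr_ge0 ?exprn_ge0.
have cst : 0 <= c * (y ^+ s - y ^+ t).
  rewrite mulr_ge0 // subr_ge0 ler_wiXn2l //; move: y4; lra.
rewrite exprS.
have := mulr_ge0 cst ct0.
have : 0 <= (1 / 4 - y) * (c * y ^+ t) by rewrite mulr_ge0 // subr_ge0.
nra.
Qed.

Lemma geo_prod_le s t : (s < t)%N -> geo_prod c y s t <= 1 - c * y ^+ s.
Proof.
move=> st; rewrite /geo_prod big_ltn // ler_piMr ?geo_factor_ge0 //.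
exact: geo_prod_le1.
Qed.

End GeoProd.

Lemma geo_prod_cat (R : realType) (c y : R) r s t : (r <= s)%N -> (s <= t)%N ->
  geo_prod c y r t = geo_prod c y r s * geo_prod c y s t.
Proof. by move=> rs st; rewrite /geo_prod (big_cat_nat rs st). Qed.

(** * The infinite product over odd exponents *)

Lemma prod_odd_geo (R : realType) (q : R) M :
  \prod_(1 <= i < (2 * M).+1 | odd i) (1 - 1 / q ^+ i) =
  geo_prod q^-1 (q^-1 ^+ 2) 0 M.
Proof.
elim: M => [|M IH]; first by rewrite /geo_prod !big_geq.
rewrite mulnS !addSn add0n big_mkcond big_nat_recr //= big_nat_recr //=.
rewrite -big_mkcond IH /geo_prod big_nat_recr //= mul2n odd_double /= mulr1.
by rewrite -exprM -exprS div1r -exprVn mul2n.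
Qed.

Section OddProd.
Variables (R : realType) (q : R).
Hypothesis q2 : 2 <= q.
Let x := q^-1.

Lemma invq_gt0 : 0 < q^-1. Proof. by rewrite invr_gt0; move: q2; lra. Qed.
Lemma invq_le : q^-1 <= 1 / 2.
Proof. rewrite div1r lef_pV2 ?posrE; move: q2; lra. Qed.
Lemma invq2_le : q^-1 ^+ 2 <= 1 / 4.
Proof. have := invq_gt0; have := invq_le; rewrite expr2; nra. Qed.

(** The infinite product is its part with exponents at most 2m+1 times a tail
    whose first factor is 1 - x^(2m+3). The partial products decrease, so one
    late partial product bounds the limit above, and a uniform lower bound on
    the tails bounds it below. *)
Lemma odd_prod_bounds m :
  geo_prod x (x ^+ 2) 0 m.+1 * (1 - 4 / 3 * x ^+ (2 * m + 3)) <= odd_prod q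
    <= geo_prod x (x ^+ 2) 0 m.+1 * (1 - x ^+ (2 * m + 3)).
Proof.
set a := geo_prod _ _ _ _.
have x0 : 0 <= x := ltW invq_gt0.
have x1 : x <= 1 by have := invq_le; rewrite -/x; lra.
have y0 : 0 <= x ^+ 2 by rewrite exprn_ge0.
have y4 : x ^+ 2 <= 1 / 4 := invq2_le.
have a0 : 0 <= a by exact: geo_prod_ge0.
have E : x ^+ (2 * m + 3) = x * (x ^+ 2) ^+ m.+1.
  by rewrite -exprM -exprS; congr (_ ^+ _); lia.
pose u N := \prod_(1 <= i < N | odd i) (1 - 1 / q ^+ i).
have f01 i : 0 <= 1 - 1 / q ^+ i <= 1.
  rewrite div1r -exprVn gerBl subr_ge0 exprn_ge0 // andbT exprn_ile1 //.
have u0 N : 0 <= u N by apply: prodr_ge0 => i _; case/andP: (f01 i).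
have u_dec : nonincreasing_seq u.
  apply/nonincreasing_seqP => -[|N]; first by rewrite /u !big_geq.
  rewrite /u big_mkcond big_nat_recr //= -big_mkcond /=.
  case: ifP => _; last by rewrite mulr1.
  by rewrite ler_piMr ?u0 //; case/andP: (f01 N.+1).
have cvu : cvgn u.
  by apply: nonincreasing_is_cvgn => //; exists 0 => _ [N _ <-].
have uE M : (m.+1 <= M)%N ->
    u (2 * M).+1 = a * geo_prod x (x ^+ 2) m.+1 M.
  by move=> mM; rewrite /u prod_odd_geo -geo_prod_cat.
rewrite /odd_prod -/u E; apply/andP; split.
  apply: limr_ge => //; near=> N.
  have mN : (m.+1 <= N)%N by near: N; exact: nbhs_infty_ge.
  apply: (@le_trans _ _ (u (2 * N).+1)); last by apply: u_dec; lia.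
  rewrite uE // ler_wpM2l //.
  apply: le_trans (geo_prod_ge x0 x1 y0 y4 _ _); lra.
apply: limr_le => //; near=> N.
have mN : ((2 * m.+2).+1 <= N)%N by near: N; exact: nbhs_infty_ge.
apply: (le_trans (u_dec _ _ mN)).
by rewrite uE // ler_wpM2l // geo_prod_le.
Unshelve. all: by end_near.
Qed.

End OddProd.

(** * A common coefficient for both mass functions *)

(** The part of [Q_mass q k] that is left when [odd_prod q] is removed. *)
Definition mass_coef (R : realType) (q : R) (k : nat) : R :=
  q ^+ (2 * k + 1) / \prod_(1 <= i < (2 * k + 1).+1) (q ^+ i - 1).

Section MassCoef.
Variables (R : realType) (q : R).
Hypothesis q2 : 2 <= q.

Lemma powq_gt1 i : 1 < q ^+ i.+1.
Proof. by rewrite exprn_egt1 //; move: q2; lra. Qed.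

Lemma powq_neq0 i : q ^+ i != 0.
Proof. by rewrite expf_neq0 //; move: q2; lra. Qed.

Lemma powq_sub1_neq0 i : q ^+ i.+1 - 1 != 0.
Proof. by have := powq_gt1 i; lra. Qed.

Lemma mass_coef_ge0 k : 0 <= mass_coef q k.
Proof.
have q0 : 0 <= q by move: q2; lra.
rewrite /mass_coef divr_ge0 ?exprn_ge0 // prodr_ge0 // => i _.
by rewrite subr_ge0 exprn_ege1 //; move: q2; lra.
Qed.

Lemma mass_coefS k : mass_coef q k.+1 = mass_coef q k *
  (q ^+ 2 / ((q ^+ (2 * k).+2 - 1) * (q ^+ (2 * k).+3 - 1))).
Proof.
rewrite /mass_coef (_ : 2 * k.+1 + 1 = (2 * k + 1).+2)%N; last lia.
rewrite 2?big_nat_recr //= addn1 !invfM -[(2 * k).+3]addn2 exprD.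
by ring.
Qed.

(** Here k + h = m is the half-rank of a generic matrix. Both sides gain the same
    factor when h grows and k shrinks with m fixed, so that induction on h
    reduces to h = 0. There the claim is the identity
    q^(C(n,2)+n) = q^(1+2+...+n), proved by induction on k. *)
Lemma rank_count_massE k h :
  rank_count q (2 * (k + h) + 1) h / q ^+ 'C(2 * (k + h) + 1, 2) =
  mass_coef q k * geo_prod q^-1 (q^-1 ^+ 2) 0 (k + h).+1 *
    geo_prod (q^-1 ^+ 2) (q^-1 ^+ 2) h (k + h).
Proof.
have q0 : q != 0 by move: q2; lra.
elim: h k => [|h IH] k.
  rewrite addn0 /rank_count muln0 !big_geq // !mul1r.
  elim: k => [|k IH].
    rewrite /geo_prod /mass_coef muln0 add0n !big_nat1 big_geq // expr1 !expr0.
    have := powq_sub1_neq0 0; rewrite expr1 => q1.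
    by field; rewrite q0 q1.
  rewrite mass_coefS /geo_prod big_nat_recr // [in X in _ * X]big_nat_recr //=.
  rewrite -!/(geo_prod _ _ _ _).
  rewrite (_ : 'C(2 * k.+1 + 1, 2) =
    'C(2 * k + 1, 2) + (2 * k).+1 + (2 * k).+2)%N; last first.
    rewrite (_ : 2 * k.+1 + 1 = (2 * k + 1).+2)%N; last lia.
    by rewrite !binS !bin1 bin0; lia.
  rewrite -addnA exprD invfM IH -!exprM -!exprD -!exprS !exprVn.
  have h2 := powq_sub1_neq0 (2 * k).+1; have h3 := powq_sub1_neq0 (2 * k).+2.
  rewrite (_ : (2 * k.+1).+1 = (2 * k).+3)%N; last lia.
  rewrite (_ : (2 + 2 * k) = (2 * k).+2)%N; last lia.
  rewrite (_ : (2 * k).+1 + (2 * k).+2 = 2 * k + (2 * k).+3)%N; last lia.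
  rewrite exprD; move: h2 h3; rewrite !exprS.
  have := powq_neq0 (2 * k); move: (q ^+ (2 * k)) => Q Q0 h2 h3.
  by rewrite !expr0; field; rewrite q0 Q0 h2 h3.
have := IH k.+1; rewrite addSnnS.
rewrite /rank_count (_ : 2 * h.+1 = (2 * h).+2)%N; last lia.
rewrite [\prod_(1 <= i < h.+2) _]big_nat_recr //=.
rewrite [\prod_(0 <= i < (2 * h).+2) _]big_nat_recr //=.
rewrite [\prod_(0 <= i < (2 * h).+1) _]big_nat_recr //=.
set n := (2 * (k + h.+1) + 1)%N.
rewrite (_ : n - 2 * h = (2 * k).+3)%N; last by rewrite /n; lia.
rewrite (_ : n - (2 * h).+1 = (2 * k).+2)%N; last by rewrite /n; lia.
rewrite (_ : 2 * h.+1 - 2 = 2 * h)%N; last lia.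
rewrite (_ : 2 * h.+1 = (2 * h).+2)%N; last lia.
rewrite mass_coefS {2}/geo_prod [\prod_(h <= j < _) _]big_ltn; last lia.
rewrite -/(geo_prod _ _ _ _) => E.
set r1 := \prod_(1 <= i < _) _ in E *.
set r2 := \prod_(0 <= i < _) _ in E *.
transitivity (r1 * r2 / q ^+ 'C(n, 2) * (q ^+ (2 * h) / (q ^+ (2 * h).+2 - 1) *
   ((q ^+ (2 * k).+3 - 1) * (q ^+ (2 * k).+2 - 1)))).
  by ring.
rewrite {}E.
set g1 := geo_prod _ _ 0 _; set g2 := geo_prod _ _ h.+1 _.
rewrite -exprM -exprD exprVn add2n.
have h2 := powq_sub1_neq0 (2 * k).+1; have h3 := powq_sub1_neq0 (2 * k).+2.
move: h2 h3 (powq_sub1_neq0 (2 * h).+1) (powq_neq0 (2 * h)).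
rewrite !exprS; move: (q ^+ (2 * k)) (q ^+ (2 * h)) => Q H h2 h3 h4 H0.
by rewrite !expr0; field; rewrite q0 h2 h3 h4 H0.
Qed.

End MassCoef.

(** * Termwise comparison of the masses *)

Section MassDifference.
Variables (R : realType) (q : R) (m : nat).
Hypothesis q2 : 2 <= q.

Lemma mass_coef0 : mass_coef q 0 * (1 - q^-1) = 1.
Proof.
rewrite /mass_coef muln0 add0n big_nat1 expr1.
have q0 : q != 0 by move: q2; lra.
have q1 : q - 1 != 0 by move: q2; lra.
by field; rewrite q0 q1.
Qed.

(** The weight q^(2k+1) is the factor by which the error of the k-th term exceeds
    x^(2m+3), and 1 - x bounds the odd product. Passing from
    the k-th weighted coefficient to the next one multiplies it by
    q^4 / ((q^(2k+2) - 1) (q^(2k+3) - 1)), at most 1/8 as soon as k >= 1. *)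
Lemma mass_coef_geometric k :
  mass_coef q k.+1 * (1 - q^-1) * q ^+ (2 * k.+1 + 1) <= 32 / 21 / 8 ^+ k.
Proof.
elim: k => [|k IH].
  rewrite mass_coefS // [mass_coef q 0 * _ * _]mulrAC.
  rewrite mass_coef0 mul1r expr0 divr1 muln0 muln1.
  have h2 := powq_gt1 q2 1; have h3 := powq_gt1 q2 2.
  rewrite mulrAC ler_pdivrMr; last by rewrite mulr_gt0 ?subr_gt0.
  have [t t0 ->] : exists2 t, 0 <= t & q = 2 + t.
    by exists (q - 2); [move: q2; lra | ring].
  (* Nonnegativity is visible from the expansion around q = 2. *)
  rewrite -subr_ge0 [leRHS](_ : _ = t * (11 * t ^+ 4 + 110 * t ^+ 3 +
    408 * t ^+ 2 + 656 * t + 368) / 21); last by field.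
  clear -t0; have t2 := exprn_ge0 2 t0; have t3 := exprn_ge0 3 t0.
  have t4 := exprn_ge0 4 t0.
  by apply: divr_ge0; [apply: mulr_ge0; lra | ].
set s := (2 * k.+1)%N in IH *.
have Q16 : 16 <= q ^+ s.+2.
  rewrite (_ : 16 = 2 ^+ 4); last by ring.
  apply: (@le_trans _ _ (q ^+ 4)).
    by rewrite lerXn2r ?nnegrE //; move: q2; lra.
  by rewrite ler_weXn2l; [|move: q2; lra | rewrite /s; lia].
have Q4 : q ^+ 4 <= q ^+ s.+2.
  by rewrite ler_weXn2l; [|move: q2; lra | rewrite /s; lia].
rewrite [leRHS](_ : _ = 8^-1 * (32 / 21 / 8 ^+ k)); last first.
  by rewrite exprS invfM mulrCA.
apply: le_trans (ler_wpM2l _ IH); last by rewrite invr_ge0.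
rewrite mass_coefS // -/s (_ : 2 * k.+2 + 1 = s + 1 + 2)%N; last first.
  by rewrite /s; lia.
rewrite exprD.
rewrite [leLHS](_ : _ = (q ^+ 4 / ((q ^+ s.+2 - 1) * (q ^+ s.+3 - 1))) *
  (mass_coef q k.+1 * (1 - q^-1) * q ^+ (s + 1))); last by ring.
rewrite ler_wpM2r //.
  apply: mulr_ge0; last by rewrite exprn_ge0 //; move: q2; lra.
  apply: mulr_ge0; first exact: mass_coef_ge0.
  by have := invq_le q2; lra.
rewrite [q ^+ s.+3]exprS; move: Q16 Q4; move: (q ^+ s.+2) (q ^+ 4) => Q P Q16 Q4.
have qQ : 2 * Q <= q * Q by rewrite ler_wpM2r //; lra.
rewrite ler_pdivrMr; last by rewrite mulr_gt0 //; lra.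
have : 15 * Q <= (Q - 1) * (q * Q - 1) by rewrite ler_pM //; lra.
lra.
Qed.

Let x := q^-1.
Let w := x ^+ (2 * m + 3).
Let a := geo_prod x (x ^+ 2) 0 m.+1.
Let D k := Qn_mass q (2 * m + 1) k - Q_mass q k.

Lemma Qn_massE k : (k <= m)%N -> Qn_mass q (2 * m + 1) k =
  mass_coef q k * (a * geo_prod (x ^+ 2) (x ^+ 2) (m - k) m).
Proof.
move=> km; rewrite /Qn_mass (_ : (2 * m + 1)./2 = m); last lia.
by rewrite km -{1 3}(subnKC km) rank_count_massE // subnKC // mulrA.
Qed.

Lemma Q_massE k : Q_mass q k = mass_coef q k * odd_prod q.
Proof. by rewrite /Q_mass mulrC. Qed.

(** The factor 1 - x stays explicit because it cancels against [mass_coef0]; the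
    factors from 1 - x^3 on multiply to at least 1 - (4/3) x^3 >= 5/6. *)
Lemma odd_part_bounds :
  (1 - q^-1) * (5 / 6) <= a <= 1 - q^-1.
Proof.
have x0 := invq_gt0 q2; have x2 := invq_le q2; have xx := invq2_le q2.
have y0 : 0 <= q^-1 ^+ 2 by rewrite exprn_ge0 // ltW.
have x1 : q^-1 <= 1 by lra.
have := geo_prod_ge (ltW x0) x1 y0 xx 1 m.+1.
have := geo_prod_le1 (ltW x0) x1 y0 xx 1 m.+1.
have -> : a = (1 - q^-1) * geo_prod q^-1 (q^-1 ^+ 2) 1 m.+1.
  by rewrite /a /geo_prod big_ltn // expr0 mulr1.
rewrite expr1 => g1 g0; rewrite ler_wpM2l ?ler_piMr ?subr_ge0 //.
apply: le_trans g0.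
have : q^-1 * q^-1 ^+ 2 <= 1 / 2 * (1 / 4) by rewrite ler_pM // ltW.
lra.
Qed.

(** At k = 0 the even correction factor is 1, so that only the tail of the odd
    product contributes to the difference. *)
Lemma mass_diff0_le : `|D 0| <= 4 / 3 * w.
Proof.
have /andP[a5 a1] := odd_part_bounds.
have /andP[b1 b2] := odd_prod_bounds q2 m.
have x2 := invq_le q2.
rewrite -/x -/a -/w in b1 b2.
have w0 : 0 <= w by rewrite exprn_ge0 // ltW // invq_gt0.
rewrite /D Qn_massE // Q_massE /geo_prod subn0 big_geq // mulr1 -mulrBr.
rewrite normrM ger0_norm ?mass_coef_ge0 //.
rewrite (_ : 4 / 3 * w = mass_coef q 0 * ((1 - q^-1) * (4 / 3 * w))); last first.
  by rewrite mulrA mass_coef0 mul1r.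
rewrite ler_wpM2l ?mass_coef_ge0 // ger0_norm; nra.
Qed.

Lemma mass_diff0_ge : 5 / 6 * w <= `|D 0|.
Proof.
have /andP[a5 a1] := odd_part_bounds.
have /andP[b1 b2] := odd_prod_bounds q2 m.
rewrite -/x -/a -/w in b1 b2.
have w0 : 0 <= w by rewrite exprn_ge0 // ltW // invq_gt0.
apply: le_trans (ler_norm _).
rewrite /D Qn_massE // Q_massE /geo_prod subn0 big_geq // mulr1 -mulrBr.
rewrite (_ : 5 / 6 * w = mass_coef q 0 * ((1 - q^-1) * (5 / 6 * w))); last first.
  by rewrite mulrA mass_coef0 mul1r.
rewrite ler_wpM2l ?mass_coef_ge0 //.
have := ler_wpM2r w0 a5; lra.
Qed.

(** Both b / a and T_k lie between 1 - (4/3) x^(2m+3) q^(2k+1) and 1, and so does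
    T_k = 0 when k > m because then x^(2m+3) q^(2k+1) >= 1. *)
Lemma mass_diffS_le k : `|D k.+1| <= 4 / 3 * w * (32 / 21 / 8 ^+ k).
Proof.
have /andP[a5 a1] := odd_part_bounds.
have /andP[b1 b2] := odd_prod_bounds q2 m.
have x0 := invq_gt0 q2; have x2 := invq_le q2; have xx := invq2_le q2.
rewrite -/x -/a -/w in b1 b2.
have w0 : 0 <= w by rewrite exprn_ge0 // ltW.
have a0 : 0 <= a by apply: le_trans a5; lra.
set v := q ^+ (2 * k.+1 + 1).
have v1 : 1 <= v by rewrite exprn_ege1 //; move: q2; lra.
apply: (@le_trans _ _
  (4 / 3 * w * (mass_coef q k.+1 * (1 - q^-1) * v))); last first.
  by rewrite ler_wpM2l ?mass_coef_geometric // mulr_ge0.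
rewrite /D; suff [T -> /andP[T0 T1]] :
    exists2 T, Qn_mass q (2 * m + 1) k.+1 = mass_coef q k.+1 * (a * T) &
      1 - 4 / 3 * (w * v) <= T <= 1.
  rewrite Q_massE -mulrBr normrM ger0_norm ?mass_coef_ge0 //.
  rewrite [leRHS](_ : _ = mass_coef q k.+1 *
    ((1 - q^-1) * (4 / 3 * (w * v)))); last by ring.
  rewrite ler_wpM2l ?mass_coef_ge0 //.
  have wv : w <= w * v by rewrite ler_peMr.
  apply: (@le_trans _ _ (a * (4 / 3 * (w * v)))).
    have aT := ler_wpM2l a0 T0; have aT1 := ler_wpM2l a0 T1.
    have awv := ler_wpM2l a0 wv; have aw := mulr_ge0 a0 w0.
    rewrite ler_norml; apply/andP; split; lra.
  by rewrite ler_wpM2r // mulr_ge0 // mulr_ge0 //; lra.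
have [km|mk] := ltnP k m.
  exists (geo_prod (x ^+ 2) (x ^+ 2) (m - k.+1) m); first exact: Qn_massE.
  have y0 : 0 <= x ^+ 2 by rewrite exprn_ge0 // ltW.
  have y1 : x ^+ 2 <= 1 by rewrite /x; lra.
  rewrite geo_prod_le1 // andbT.
  suff -> : w * v = x ^+ 2 * x ^+ 2 ^+ (m - k.+1) by rewrite mulrA geo_prod_ge.
  rewrite -exprM -exprD /w /v.
  rewrite (_ : 2 * m + 3 = 2 + 2 * (m - k.+1) + (2 * k.+1 + 1))%N; last first.
    by clear -km; lia.
  by rewrite exprD -mulrA -exprMn mulVf ?expr1n ?mulr1 //; move: q2; lra.
exists 0.
  rewrite /Qn_mass (_ : (2 * m + 1)./2 = m); last by clear; lia.
  by rewrite ltnNge mk !mulr0.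
rewrite ler01 andbT subr_le0.
suff : 1 <= w * v by lra.
have q0 : 0 < q by move: q2; lra.
rewrite /w exprVn mulrC ler_pdivlMr ?exprn_gt0 // mul1r /v.
by rewrite ler_weXn2l; [|move: q2; lra | clear -mk; lia].
Qed.

(** The total is at most 4/3 + (4/3) (32/21) (8/7) < 4.4 in units of x^(2m+3). *)
Lemma sum_mass_diff_le N : \sum_(0 <= k < N) `|D k| <= 44 / 10 * w.
Proof.
have w0 : 0 <= w by rewrite exprn_ge0 // ltW // invq_gt0.
case: N => [|N]; first by rewrite big_geq // mulr_ge0.
suff : \sum_(0 <= k < N.+1) `|D k| <=
    w * (4 / 3 + 4 / 3 * (32 / 21) * (8 / 7) * (1 - 1 / 8 ^+ N)).
  have : 0 <= w * (1 / 8 ^+ N) by rewrite mulr_ge0 // divr_ge0 // exprn_ge0.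
  lra.
elim: N => [|N IH].
  by rewrite big_nat1 expr0; have := mass_diff0_le; lra.
rewrite big_nat_recr //=; have := mass_diffS_le N.
rewrite exprS invfM; lra.
Qed.

End MassDifference.

Theorem theorem5p5 (R : realType) (q : R) (m n : nat)
    (hq : 2 <= q) (hn : n = (2 * m + 1)%N) :
  ((37 / 100 / q ^+ (n + 2))%:E <= tv_dist (Qn_mass q n) (Q_mass q))%E /\
  (tv_dist (Qn_mass q n) (Q_mass q) <= (22 / 10 / q ^+ (n + 2))%:E)%E.
Proof.
rewrite /tv_dist {}hn.
have E (c : R) : c / q ^+ (2 * m + 1 + 2) = 2^-1 * (2 * c * q^-1 ^+ (2 * m + 3)).
  by rewrite -addnA exprVn; field; rewrite powq_neq0.
have w0 : 0 <= q^-1 ^+ (2 * m + 3) by rewrite exprn_ge0 // ltW // invq_gt0.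
rewrite !E !EFinM; split; (apply: lee_wpmul2l; first by rewrite lee_fin).
  apply: le_trans (nneseries_lim_ge 1 _); last by move=> k _ _; rewrite lee_fin.
  rewrite big_nat1 lee_fin.
  by apply: le_trans (mass_diff0_ge m hq); lra.
apply: lime_le.
  by apply: is_cvg_nneseries => k _ _; rewrite lee_fin.
apply: nearW => N; rewrite sumEFin lee_fin.
by apply: le_trans (sum_mass_diff_le m hq N) _; lra.
Qed.
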